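(* Let $0<q<1$, let $I$ be an open interval, and let $p(x), r(x)$ be continuous functions on $I$. Let $y(x)$ be a solution on $I$ of $$\frac1q D_{q^{-1}}D_q y(x)+p(x)D_{q^{-1}}y(x)+r(x)y(x)=0,$$ and let $f(x)$ be a solution on $I$ of $$\frac1q D_{q^{-1}}f(x)=p(x)f(x).$$ Let $u(x)$ be a continuous function on $I$ and let $h(x)$ be an arbitrary function satisfying $D_qh(x)=u(x)h(x)$ for $x\in I$. Then $$\int f(x)\,h(x/q)\Big(\frac1q D_{q^{-1}}u(x)+\frac1q u(x)u(x/q)+A(x)u(x/q)+r(x)\Big)y(x)\,d_qx = f(x/q)\,h(x/q)\Big(y(x/q)u(x/q)-D_{q^{-1}}y(x)\Big),$$ where $$A(x)=p(x)-\frac1q x(1-q)r(x).$$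
   Context: For $x\neq0$, $D_qf(x)=\dfrac{f(x)-f(qx)}{(1-q)x}$ and $D_{q^{-1}}f(x)=\dfrac{f(x)-f(x/q)}{(1-q^{-1})x}$. The indefinite $q$-integral $\int F(x)\,d_qx=G(x)$ means $D_qG(x)=F(x)$. All functions are understood to be defined, and the equations to hold, at the points among $x, qx, x/q$ that occur in the formulas. *)

(* Defs.v *)
From mathcomp Require Import all_boot all_order all_algebra.
From mathcomp Require Import all_classical all_reals all_analysis.

Set Implicit Arguments.
Unset Strict Implicit.
Unset Printing Implicit Defensive.

Import Order.TTheory GRing.Theory Num.Theory.
Import numFieldNormedType.Exports.

Local Open Scope classical_set_scope.
Local Open Scope ring_scope.

(* The Jackson derivative, meaningful for x != 0 only (at 0 it takes the junk
   value 0).  The operator D_{q^-1} is [Dq q^-1]: it evaluates f at x and at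
   q^-1 * x = x / q. *)
Definition Dq (R : realType) (q : R) (f : R -> R) (x : R) : R :=
  (f x - f (q * x)) / ((1 - q) * x).

(* [is_qintegral q D F G]: the indefinite q-integral of F is G on D.  The
   point 0 is left out because Dq is only defined away from it. *)
Definition is_qintegral (R : realType) (q : R) (D : set R) (F G : R -> R) :=
  forall x, D x -> x != 0 -> Dq q G x = F x.

(* Main.v *)
Require Import Defs.
From mathcomp Require Import all_boot all_order all_algebra.
From mathcomp Require Import all_classical all_reals all_analysis.
From mathcomp Require Import ring.

Set Implicit Arguments.
Unset Strict Implicit.
Unset Printing Implicit Defensive.

Import Order.TTheory GRing.Theory Num.Theory.
Import numFieldNormedType.Exports.

Local Open Scope classical_set_scope.
Local Open Scope ring_scope.

(* With k = (1 - q) x and d = D_{q^-1} y (x), the equations for y, f and h read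
   y(x/q) = y(x) + k d / q,            D_q y (x) = d + k (p d + r y(x)),
   f(x/q) = f(x) (1 + k p),            h(x) = h(x/q) (1 - k u(x/q) / q),
   and D_{q^-1} y (q x) = D_q y (x).  Substituting them into the difference of
   the primitive at x and q x, the terms in d cancel. *)

Theorem theorem2p1 (R : realType) (q : R) (I : set R) (p r y f u h : R -> R)
  (q_gt0 : 0 < q) (q_lt1 : q < 1)
  (I_open : open I) (I_itv : is_interval I)
  (p_cont : {within I, continuous p}) (r_cont : {within I, continuous r})
  (y_sol : forall x, I x -> x != 0 ->
    q^-1 * Dq q^-1 (Dq q y) x + p x * Dq q^-1 y x + r x * y x = 0)
  (f_sol : forall x, I x -> x != 0 -> q^-1 * Dq q^-1 f x = p x * f x)
  (u_cont : {within I, continuous u})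
  (h_sol : forall x, I x -> x != 0 -> Dq q h x = u x * h x) :
  let A := fun x => p x - q^-1 * x * (1 - q) * r x in
  is_qintegral q
    [set x | I x /\ Dq q h (x / q) = u (x / q) * h (x / q)]
    (fun x => f x * h (x / q) *
       (q^-1 * Dq q^-1 u x + q^-1 * u x * u (x / q) + A x * u (x / q) + r x) *
       y x)
    (fun x => f (x / q) * h (x / q) * (y (x / q) * u (x / q) - Dq q^-1 y x)).
Proof.
move=> A x [Ix hxq] x0.
have q0 : q != 0 by rewrite gt_eqF.
have q1 : 1 - q != 0 by rewrite subr_eq0 gt_eqF.
have q1' : q - 1 != 0 by rewrite subr_eq0 lt_eqF.
have := y_sol x Ix x0; have := f_sol x Ix x0; move: hxq.
(* Normalising the shifts leaves only values at [x], [x / q] and [x * q]; taken at [x / q], the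
   equation for [h] links [h (x / q)] to [h x]. *)
rewrite /A /Dq !(mulrC q^-1 x) (mulrC q (x / q)) divfK // (mulrC q x) mulfK //.
rewrite (mulrC q^-1 (x * q)) mulfK //.
set d := (y x - y (x / q)) / _ => hE fE yE.
have ydE : y (x / q) = y x + (1 - q) * x * d / q.
  by rewrite /d; field; rewrite x0 q0 q1'.
have yqE : y (x * q) =
    y x - (1 - q) * x * (d + (1 - q) * x * (p x * d + r x * y x)).
  (* The equation trades [p x * d + r x * y x] for minus the second-order term, leaving an identity
     in the three values of [y]. *)
  rewrite -(addrA (q^-1 * _)) in yE; rewrite -(addr0_eq yE) /d.
  by field; rewrite x0 q0 q1 q1'.
have fdE : f (x / q) = f x * (1 + (1 - q) * x * p x).
  transitivity (f x + (1 - q) * x * (p x * f x)); last by ring.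
  by rewrite -fE; field; rewrite x0 q0 q1'.
have hdE : h x = h (x / q) * (1 - (1 - q) * x * u (x / q) / q).
  transitivity (h (x / q) - (1 - q) * x / q * (u (x / q) * h (x / q))).
    by rewrite -hE; field; rewrite x0 q0 q1.
  by ring.
(* With [d] opaque, [y x], [d], [f x] and [h (x / q)] are independent unknowns of a rational
   identity. *)
clearbody d; rewrite fdE hdE yqE ydE; field.
by rewrite x0 q0 q1 q1'.
Qed.
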